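(* Let $T$ be a tomographically local GPT and let $sT$ be a swirled version of $T$. A causal structure admits of an $sT$-$T$ gap only if it admits of a CPT-$T$ gap, where CPT stands for classical probability theory.
   Context: GPT. A tomographically local GPT $T$ consists of a collection of systems closed under composition (with a trivial system); each system $S$ has a finite-dimensional real vector space $V_S$, with $V_{AB}=V_A\otimes V_B$ and $V_{\rm trivial}=\mathbb{R}$. For each pair $A,B$ there is a convex set of linear maps $V_A\to V_B$, the (valid) transformations; states are the transformations from the trivial system and effects those to the trivial system. States span $V_S$ and effects span its dual. Transformations contain identities and swaps and are closed under sequential and parallel composition; every closed circuit evaluates to a number in $[0,1]$. Each system has a unit effect $u_S$ with $u_{AB}=u_A\otimes u_B$; a transformation $\mathcal{E}:A\to B$ is deterministic if $u_B\circ\mathcal{E}=u_A$. $T$ contains classical probability theory (CPT): for each finite set $X$ there is a classical system with $V=\mathbb{R}^X$, transformations between classical systems being exactly the substochastic matrices (deterministic: stochastic matrices), and transformations can be conditioned on classical systems. Swirling. A symmetry of $T$ is a finite group $G$ with, for each system $S$, a representation $g\mapsto\mathcal{F}^S_g$ by invertible linear maps on $V_S$, acting collectively on composites ($\mathcal{F}^{AB}_g=\mathcal{F}^A_g\otimes\mathcal{F}^B_g$), trivially on classical systems, preserving the sets of states and of effects and the unit effect, and mapping transformations to transformations by conjugation. It is nonphysical if some $\mathcal{F}^S_g$ is not a valid transformation of $T$. The swirled theory $sT$ for a nonphysical symmetry is the subtheory of $T$ with all and only the invariant states and effects and all and only the covariant transformations ($\mathcal{E}\circ\mathcal{F}^A_g=\mathcal{F}^B_g\circ\mathcal{E}$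 for all $g$). Causal structures. A causal structure (with unrestricted gates) is a finite directed acyclic circuit shape consisting of gates connected by wires. Each wire is either latent (stipulated to be a GPT wire or a classical wire) or an observed classical variable. Each observed variable is either an open input or the output of exactly one gate; it may be copied and fed to any number of gates (acyclically), and each observed variable output by a gate is an open output. Each latent wire is the output of exactly one gate and the input of exactly one gate. For a theory $T'$ (such as $T$, $sT$ or CPT), open inputs $\mathbf{I}$ and open outputs $\mathbf{O}$ with finite alphabets, $P(\mathbf{O}|\mathbf{I})$ is $T'$-realizable in the causal structure if one can assign systems of $T'$ to latent GPT wires, finite classical systems to latent classical wires, and deterministic transformations of $T'$ to gates so that the circuit yields $P(\mathbf{O}|\mathbf{I})$. For a subtheory $T'$ of $T$, the causal structure admits of a $T'$-$T$ gap if the set of $T$-realizable distributions is a strict superset of the set of $T'$-realizable distributions (for some choice of finite alphabets). *)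

(* Defs.v *)
From HB Require Import structures.
From mathcomp Require Import all_boot all_order all_algebra all_fingroup.
From mathcomp Require Import reals.

Set Implicit Arguments.
Unset Strict Implicit.
Unset Printing Implicit Defensive.

Import GRing.Theory.
Local Open Scope ring_scope.

(* Systems of a tomographically local theory.  The conditions V_{AB} = V_A (x)
   V_B, V_triv = R and V_{cl X} = R^X are stated up to canonical isomorphism:
   [tens] is a bilinear map sending a pair of bases to a basis, [one] spans
   V_triv, and [pt] enumerates the point distributions, a basis of V_{cl X}. *)
Record systems (R : realType) := Systems {
  sys :> Type;
  triv : sys;
  comp : sys -> sys -> sys;
  V : sys -> vectType R;
  one : V triv;
  tens : forall A B, {bilinear V A -> V B -> V (comp A B)};
  cl : finType -> sys;
  pt : forall X : finType, X -> V (cl X);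
  one_basis : basis_of fullv [:: one];
  tens_basis : forall A B (X : seq (V A)) (Y : seq (V B)),
    basis_of fullv X -> basis_of fullv Y ->
    basis_of fullv [seq tens A B x y | x <- X, y <- Y];
  pt_basis : forall X : finType, basis_of fullv [seq pt x | x : X]
}.

Arguments triv {R s}.
Arguments V {R s}.
Arguments comp {R s}.
Arguments one {R s}.
Arguments tens {R s A B}.
Arguments cl {R s}.
Arguments pt {R s X}.

Section Systems.
Variables (R : realType) (S : systems R).
Implicit Types A B C D : S.

Definition scal : V (triv : S) -> R := coord [tuple one] ord0.

Definition is_par A B C D (f : 'Hom(V A, V B)) (g : 'Hom(V C, V D))
    (h : 'Hom(V (comp A C), V (comp B D))) : Prop :=
  forall a c, h (tens a c) = tens (f a) (g c).

Definition is_swap A B (h : 'Hom(V (comp A B), V (comp B A))) : Prop :=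
  forall a b, h (tens a b) = tens b a.

Definition substochastic (X Y : finType) (M : X -> Y -> R) : Prop :=
  (forall x y, 0 <= M x y) /\ (forall x, \sum_y M x y <= 1).

Definition is_matrix_of (X Y : finType) (f : 'Hom(V (cl X : S), V (cl Y : S)))
    (M : X -> Y -> R) : Prop :=
  forall x, f (pt x) = \sum_y M x y *: pt y.

Inductive is_classical : S -> Prop :=
| classical_triv : is_classical triv
| classical_cl (X : finType) : is_classical (cl X)
| classical_comp A B :
    is_classical A -> is_classical B -> is_classical (comp A B).

Lemma tens_ext A B (W : vectType R) (f g : 'Hom(V (comp A B), W)) :
  (forall a b, f (tens a b) = g (tens a b)) -> f = g.
Proof.
move=> fg; apply/lfunP => v.
have /andP[/eqP spanX _] := tens_basis (vbasisP (@fullv _ (V A)))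
  (vbasisP (@fullv _ (V B))).
move: spanX; set X := (X in span X) => spanX.
have vX : v \in <<in_tuple X>>%VS by rewrite spanX memvf.
rewrite (coord_span vX) !linear_sum; apply: eq_bigr => i _.
rewrite !linearZ /=; congr (_ *: _).
have /allpairsP[[x y] [_ _ ->]] := mem_nth 0 (ltn_ord i : i < size X)%N.
exact: fg.
Qed.

(* The linear map on V_{AB} induced by a bilinear map [b] on V_A x V_B. *)
Definition tlift A B (W : vectType R) (b : V A -> V B -> W) :
    'Hom(V (comp A B), W) :=
  linfun (sval (linear_of_free
    [seq tens x y | x <- vbasis (@fullv _ (V A)), y <- vbasis (@fullv _ (V B))]
    [seq b x y | x <- vbasis (@fullv _ (V A)), y <- vbasis (@fullv _ (V B))])).

Lemma tlift_tens A B (W : vectType R) (b : {bilinear V A -> V B -> W}) x y :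
  tlift b (tens x y) = b x y.
Proof.
set XA := vbasis (@fullv _ (V A)); set XB := vbasis (@fullv _ (V B)).
have basisT := tens_basis (vbasisP (@fullv _ (V A)))
  (vbasisP (@fullv _ (V B))).
have onbasis u v : u \in XA -> v \in XB -> tlift b (tens u v) = b u v.
  move=> uX vX; rewrite lfunE /=.
  case: linear_of_free => f /= /(_ (basis_free basisT)).
  rewrite !size_allpairs => /(_ erefl).
  rewrite map_allpairs => /eq_in_allpairs; exact.
rewrite (coord_vbasis (memvf x)) (coord_vbasis (memvf y)) -/XA -/XB.
rewrite !linear_sumlz linear_sum; apply: eq_bigr => i _.
rewrite !linear_sumr linear_sum; apply: eq_bigr => j _.
rewrite !linearZl_LR !linearZr_LR !linearZ /= onbasis ?mem_nth ?size_tuple //.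
by rewrite !scalerA mulrC.
Qed.

End Systems.

Arguments is_classical {R S}.

(* The structural fields are stated for every linear map satisfying the
   defining equation; there is exactly one such map, by [tens_ext] and
   [tlift_tens].  Associators and unitors are listed because composition of
   systems is not assumed strictly associative and unital; for the same reason
   the last four fields identify cl X . cl Y with cl (X * Y) and the trivial
   system with cl unit, as in classical probability theory. *)
Record gpt (R : realType) := Gpt {
  gsys :> systems R;
  trans : forall A B : gsys, 'Hom(V A, V B) -> Prop;
  unit_eff : forall A : gsys, 'Hom(V A, V triv);

  trans_convex : forall (A B : gsys) (p : R) (f g : 'Hom(V A, V B)),
    0 <= p <= 1 -> trans f -> trans g -> trans (p *: f + (1 - p) *: g);
  trans_id : forall A : gsys, trans (\1%VF : 'End(V A));
  trans_comp : forall (A B C : gsys) (g : 'Hom(V B, V C)) (f : 'Hom(V A, V B)),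
    trans g -> trans f -> trans (g \o f)%VF;
  trans_par : forall (A B C D : gsys)
      (f : 'Hom(V A, V B)) (g : 'Hom(V C, V D))
      (h : 'Hom(V (comp A C), V (comp B D))),
    trans f -> trans g -> is_par f g h -> trans h;
  trans_swap : forall (A B : gsys) (h : 'Hom(V (comp A B), V (comp B A))),
    is_swap h -> trans h;
  trans_assoc : forall (A B C : gsys)
      (h : 'Hom(V (comp (comp A B) C), V (comp A (comp B C)))),
    (forall a b c, h (tens (tens a b) c) = tens a (tens b c)) -> trans h;
  trans_assocV : forall (A B C : gsys)
      (h : 'Hom(V (comp A (comp B C)), V (comp (comp A B) C))),
    (forall a b c, h (tens a (tens b c)) = tens (tens a b) c) -> trans h;
  trans_unitor : forall (A : gsys) (h : 'Hom(V (comp triv A), V A)),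
    (forall a, h (tens one a) = a) -> trans h;
  trans_unitorV : forall (A : gsys) (h : 'Hom(V A, V (comp triv A))),
    (forall a, h a = tens one a) -> trans h;
  closed_circuit : forall f : 'End(V (triv : gsys)),
    trans f -> 0 <= scal (f one) <= 1;

  states_span : forall A : gsys, exists2 s : seq 'Hom(V triv, V A),
    (forall f, f \in s -> trans f) &
    <<[seq (f : 'Hom(V triv, V A)) one | f <- s]>>%VS = fullv;
  effects_span : forall A : gsys, exists2 s : seq 'Hom(V A, V triv),
    (forall f, f \in s -> trans f) & <<s>>%VS = fullv;

  unit_trans : forall A : gsys, trans (unit_eff A);
  unit_triv : unit_eff triv = \1%VF;
  unit_comp : forall (A B : gsys) (a : V A) (b : V B),
    scal (unit_eff (comp A B) (tens a b)) =
    scal (unit_eff A a) * scal (unit_eff B b);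

  unit_pt : forall (X : finType) (x : X), unit_eff (cl X) (pt x) = one;
  trans_cl : forall (X Y : finType) (f : 'Hom(V (cl X : gsys), V (cl Y : gsys))),
    trans f <-> exists2 M, substochastic M & is_matrix_of f M;
  trans_cond : forall (X : finType) (A B : gsys) (E : X -> 'Hom(V A, V B))
      (h : 'Hom(V (comp (cl X) A), V B)),
    (forall x, trans (E x)) ->
    (forall x a, h (tens (pt x) a) = E x a) -> trans h;
  trans_pair : forall (X Y : finType)
      (h : 'Hom(V (comp (cl X) (cl Y) : gsys), V (cl (X * Y)%type : gsys))),
    (forall x y, h (tens (pt x) (pt y)) = pt (x, y)) -> trans h;
  trans_pairV : forall (X Y : finType)
      (h : 'Hom(V (cl (X * Y)%type : gsys), V (comp (cl X) (cl Y) : gsys))),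
    (forall x y, h (pt (x, y)) = tens (pt x) (pt y)) -> trans h;
  trans_tt : forall h : 'Hom(V (triv : gsys), V (cl unit : gsys)),
    h one = pt tt -> trans h;
  trans_ttV : forall h : 'Hom(V (cl unit : gsys), V (triv : gsys)),
    h (pt tt) = one -> trans h
}.

Arguments trans {R T A B} : rename.
Arguments unit_eff {R T} : rename.

Definition deterministic (R : realType) (T : gpt R) (A B : T)
    (f : 'Hom(V A, V B)) : Prop :=
  (unit_eff B \o f)%VF = unit_eff A.

Record subtheory (R : realType) (T : gpt R) := Subtheory {
  sub_sys : T -> Prop;
  sub_trans : forall A B : T, 'Hom(V A, V B) -> Prop;
  sub_triv : sub_sys triv;
  sub_sys_comp : forall A B : T, sub_sys A -> sub_sys B -> sub_sys (comp A B);
  sub_trans_sub : forall (A B : T) (f : 'Hom(V A, V B)),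
    sub_trans f -> [/\ sub_sys A, sub_sys B & trans f];
  sub_trans_id : forall A : T, sub_sys A -> sub_trans (\1%VF : 'End(V A));
  sub_trans_swap : forall (A B : T) (h : 'Hom(V (comp A B), V (comp B A))),
    sub_sys A -> sub_sys B -> is_swap h -> sub_trans h;
  sub_trans_comp : forall (A B C : T)
      (g : 'Hom(V B, V C)) (f : 'Hom(V A, V B)),
    sub_trans g -> sub_trans f -> sub_trans (g \o f)%VF;
  sub_trans_par : forall (A B C D : T)
      (f : 'Hom(V A, V B)) (g : 'Hom(V C, V D))
      (h : 'Hom(V (comp A C), V (comp B D))),
    sub_trans f -> sub_trans g -> is_par f g h -> sub_trans h
}.

Arguments sub_trans {R T} s {A B}.

Definition whole (R : realType) (T : gpt R) : subtheory T :=
  @Subtheory R T (fun _ => True) (fun A B f => trans f)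
    I (fun _ _ _ _ => I) (fun _ _ _ tf => And3 I I tf)
    (fun A _ => trans_id A) (fun _ _ _ _ _ hS => trans_swap hS)
    (@trans_comp R T) (@trans_par R T).

Section CPT.
Variables (R : realType) (T : gpt R).

Definition cpt_trans (A B : T) (f : 'Hom(V A, V B)) : Prop :=
  [/\ is_classical A, is_classical B & trans f].

Lemma cpt_id (A : T) : is_classical A -> cpt_trans (\1%VF : 'End(V A)).
Proof. by move=> cA; split=> //; exact: trans_id. Qed.

Lemma cpt_swap (A B : T) (h : 'Hom(V (comp A B), V (comp B A))) :
  is_classical A -> is_classical B -> is_swap h -> cpt_trans h.
Proof.
by move=> cA cB hS; split; [exact: classical_comp.. | exact: trans_swap hS].
Qed.

Lemma cpt_comp (A B C : T) (g : 'Hom(V B, V C)) (f : 'Hom(V A, V B)) :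
  cpt_trans g -> cpt_trans f -> cpt_trans (g \o f)%VF.
Proof. by move=> [? ? ?] [? ? ?]; split=> //; exact: trans_comp. Qed.

Lemma cpt_par (A B C D : T) (f : 'Hom(V A, V B)) (g : 'Hom(V C, V D))
    (h : 'Hom(V (comp A C), V (comp B D))) :
  cpt_trans f -> cpt_trans g -> is_par f g h -> cpt_trans h.
Proof.
move=> [? ? tf] [? ? tg] fgh.
by split; [exact: classical_comp.. | exact: trans_par tf tg fgh].
Qed.

(* By [trans_cl] and the identifications of classical composites, [cpt_trans]
   holds of exactly the substochastic matrices between classical systems. *)
Definition CPT : subtheory T :=
  @Subtheory R T is_classical cpt_trans
    (classical_triv T) (@classical_comp R T) (fun _ _ _ => id)
    cpt_id cpt_swap cpt_comp cpt_par.

End CPT.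

Record symmetry (R : realType) (T : gpt R) := Symmetry {
  sgrp : finGroupType;
  sact : sgrp -> forall A : T, 'End(V A);
  sact1 : forall A : T, sact 1%g A = \1%VF;
  sactM : forall g h (A : T), sact (g * h)%g A = (sact g A \o sact h A)%VF;
  sact_comp : forall g (A B : T),
    is_par (sact g A) (sact g B) (sact g (comp A B));
  sact_cl : forall g (X : finType), sact g (cl X) = \1%VF;
  sact_state : forall g (A : T) (f : 'Hom(V triv, V A)),
    trans f -> trans (sact g A \o f)%VF;
  sact_effect : forall g (A : T) (f : 'Hom(V A, V triv)),
    trans f -> trans (f \o sact g A)%VF;
  sact_unit : forall g (A : T), (unit_eff A \o sact g A)%VF = unit_eff A;
  sact_trans : forall g (A B : T) (f : 'Hom(V A, V B)),
    trans f -> trans (sact g B \o f \o sact g^-1%g A)%VF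
}.

Arguments sact {R T} s g A.

Definition nonphysical (R : realType) (T : gpt R) (F : symmetry T) : Prop :=
  exists g (A : T), ~ trans (sact F g A).

Definition covariant (R : realType) (T : gpt R) (F : symmetry T) (A B : T)
    (f : 'Hom(V A, V B)) : Prop :=
  forall g, (f \o sact F g A)%VF = (sact F g B \o f)%VF.

Lemma sact_triv (R : realType) (T : gpt R) (F : symmetry T) g :
  sact F g triv = \1%VF.
Proof. by have := sact_unit g (triv : T); rewrite unit_triv comp_lfun1l. Qed.

Section Swirl.
Variables (R : realType) (T : gpt R) (F : symmetry T).

(* As the action on the trivial system is the identity ([sact_triv]), covariant
   states and effects are the invariant ones. *)
Definition swirl_trans (A B : T) (f : 'Hom(V A, V B)) : Prop :=
  trans f /\ covariant F f.

Lemma swirl_id (A : T) : swirl_trans (\1%VF : 'End(V A)).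
Proof.
split; first exact: trans_id.
by move=> g; rewrite comp_lfun1l comp_lfun1r.
Qed.

Lemma swirl_swap (A B : T) (h : 'Hom(V (comp A B), V (comp B A))) :
  is_swap h -> swirl_trans h.
Proof.
move=> hS; split; first exact: trans_swap hS.
by move=> g; apply: tens_ext => a b; rewrite !comp_lfunE sact_comp !hS sact_comp.
Qed.

Lemma swirl_comp (A B C : T) (k : 'Hom(V B, V C)) (f : 'Hom(V A, V B)) :
  swirl_trans k -> swirl_trans f -> swirl_trans (k \o f)%VF.
Proof.
move=> [tk ck] [tf cf]; split; first exact: trans_comp.
by move=> g; rewrite -comp_lfunA cf !comp_lfunA ck.
Qed.

Lemma swirl_par (A B C D : T) (f : 'Hom(V A, V B)) (k : 'Hom(V C, V D))
    (h : 'Hom(V (comp A C), V (comp B D))) :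
  swirl_trans f -> swirl_trans k -> is_par f k h -> swirl_trans h.
Proof.
move=> [tf cf] [tk ck] fkh; split; first exact: trans_par tf tk fkh.
move=> g; apply: tens_ext => a c.
rewrite !comp_lfunE sact_comp !fkh sact_comp.
by rewrite -[f (_ a)]comp_lfunE cf -[k (_ c)]comp_lfunE ck !comp_lfunE.
Qed.

Definition swirl : subtheory T :=
  @Subtheory R T (fun _ => True) swirl_trans
    I (fun _ _ _ _ => I) (fun _ _ _ tf => And3 I I (proj1 tf))
    (fun A _ => swirl_id A) (fun _ _ _ _ _ hS => swirl_swap hS)
    swirl_comp swirl_par.

End Swirl.

(* [inp] and [out] are the observed variables that are open inputs and gate
   outputs; [feeds v g] says that a copy of the observed variable [v] enters
   gate [g].  A latent wire has one source and one target. *)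
Record causal_shape := CausalShape {
  gate : finType;
  latent : finType;
  inp : finType;
  out : finType;
  latent_cl : pred latent;
  latent_src : latent -> gate;
  latent_tgt : latent -> gate;
  out_src : out -> gate;
  feeds : inp + out -> pred gate
}.

Definition gate_edge (C : causal_shape) : rel (gate C) := fun g h =>
  [exists l : latent C, (latent_src l == g) && (latent_tgt l == h)]
  || [exists o : out C, (out_src o == g) && feeds (inr o) h].

Record causal_structure := CausalStructure {
  shape :> causal_shape;
  shape_acyclic : forall g h : gate shape,
    gate_edge g h -> ~~ connect (@gate_edge shape) h g
}.

Section Circuit.
Variables (R : realType) (T : gpt R) (C : causal_structure).
Variables (alph : inp C + out C -> finType) (lat : latent C -> T).

Definition wire := (latent C + (inp C + out C))%type.

Definition wire_sys (w : wire) : T :=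
  match w with inl l => lat l | inr v => cl (alph v) end.

Definition gate_in (g : gate C) : seq wire :=
  [seq w <- enum {: wire} |
    match w with inl l => latent_tgt l == g | inr v => feeds v g end].

Definition gate_out (g : gate C) : seq wire :=
  [seq w <- enum {: wire} |
    match w with
    | inl l => latent_src l == g
    | inr (inl _) => false
    | inr (inr o) => out_src o == g
    end].

Definition bundle (s : seq wire) : T :=
  foldr (fun w A => comp (wire_sys w) A) triv s.

Definition gate_maps :=
  forall g : gate C, 'Hom(V (bundle (gate_in g)), V (bundle (gate_out g))).

Definition latent_index :=
  {dffun forall l : latent C, 'I_(\dim (@fullv _ (V (lat l))))}.

Section Value.
Variables (E : gate_maps).
Variables (xi : forall i, alph (inl i)) (xo : forall o, alph (inr o)).

Definition obs_val (v : inp C + out C) : alph v :=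
  match v with inl i => xi i | inr o => xo o end.

Definition wire_vec (a : latent_index) (w : wire) : V (wire_sys w) :=
  match w with
  | inl l => (vbasis (@fullv _ (V (lat l))))`_(a l)
  | inr v => pt (obs_val v)
  end.

Definition wire_coord (a : latent_index) (w : wire) : V (wire_sys w) -> R :=
  match w with
  | inl l => coord (vbasis (@fullv _ (V (lat l)))) (a l)
  | inr v => coord [tuple of [seq pt x | x : alph v]] (enum_rank (obs_val v))
  end.

Fixpoint bundle_vec (a : latent_index) (s : seq wire) : V (bundle s) :=
  match s with
  | [::] => one
  | w :: s' => tens (wire_vec a w) (bundle_vec a s')
  end.

Fixpoint bundle_coord (a : latent_index) (s : seq wire) :
    V (bundle s) -> R :=
  match s with
  | [::] => @scal R T
  | w :: s' => tlift (W := R^o) (fun v v' =>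
      wire_coord a v * bundle_coord a v')
  end.

(* Evaluation by inserting a resolution of the identity on each latent wire,
   a basis together with its dual basis: the product over the gates of the
   matrix entries of their transformations, summed over the latent indices.
   Each observed variable carries its prescribed value at every copy. *)
Definition circuit_value : R :=
  \sum_(a : latent_index) \prod_(g : gate C)
    bundle_coord a (E g (bundle_vec a (gate_in g))).

End Value.
End Circuit.

(* P xi xo is the probability P(O = xo | I = xi). *)
Definition realizable (R : realType) (T : gpt R) (T' : subtheory T)
    (C : causal_structure) (alph : inp C + out C -> finType)
    (P : (forall i, alph (inl i)) -> (forall o, alph (inr o)) -> R) : Prop :=
  exists (lat : latent C -> T) (E : gate_maps alph lat),
    [/\ forall l,
          if latent_cl l then is_classical (lat l) else sub_sys T' (lat l),
        forall g, sub_trans T' (E g) /\ deterministic (E g) &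
        forall xi xo, P xi xo = circuit_value E xi xo].

Definition admits_gap (R : realType) (T : gpt R) (T' : subtheory T)
    (C : causal_structure) : Prop :=
  exists alph : inp C + out C -> finType,
    (forall P, realizable (alph := alph) T' P ->
               realizable (alph := alph) (whole T) P) /\
    (exists P, realizable (alph := alph) (whole T) P /\
               ~ realizable (alph := alph) T' P).

(* Main.v *)
(* A symmetry acts trivially on classical systems, so CPT is a subtheory of sT:
   a distribution that is T- but not sT-realizable is not CPT-realizable. *)
Require Import Defs.
From mathcomp Require Import all_boot all_algebra all_fingroup.
From mathcomp Require Import reals.

(** Realizability is monotone under inclusion of subtheories ([realizable_mono]), and CPT lies in
    the swirled theory, which lies in [T] ([cpt_trans_swirl]). Hence a distribution separating the
    swirled theory from [T] also separates CPT from [T], with the same alphabets. *)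

Lemma sact_classical (R : realType) (T : gpt R) (F : symmetry T)
    (g : sgrp F) (A : T) : is_classical A -> sact F g A = \1%VF.
Proof.
(* Composites inherit triviality because the action is collective and product vectors determine a
   linear map. *)
elim=> [|X|B D _ IHB _ IHD]; first exact: sact_triv.
  exact: sact_cl.
by apply: tens_ext => b d; rewrite sact_comp IHB IHD !id_lfunE.
Qed.

(** With identity actions at both ends, covariance reads [f] = [f]. *)
Lemma cpt_trans_swirl (R : realType) (T : gpt R) (F : symmetry T) (A B : T)
    (f : 'Hom(V A, V B)) : cpt_trans f -> swirl_trans F f.
Proof.
move=> [cA cB tf]; split=> // g.
by rewrite !sact_classical // comp_lfun1l comp_lfun1r.
Qed.

(** The same circuit serves in both theories: determinism, circuit values and the condition on
    classical wires do not depend on the subtheory. *)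
Lemma realizable_mono (R : realType) (T : gpt R) (T1 T2 : subtheory T)
    (C : causal_structure) (alph : inp C + out C -> finType)
    (P : (forall i, alph (inl i)) -> (forall o, alph (inr o)) -> R) :
  (forall A : T, sub_sys T1 A -> sub_sys T2 A) ->
  (forall (A B : T) (f : 'Hom(V A, V B)), sub_trans T1 f -> sub_trans T2 f) ->
  realizable (alph := alph) T1 P -> realizable (alph := alph) T2 P.
Proof.
move=> sys12 trans12 [lat [E [latP EP valP]]]; exists lat, E; split=> //.
  by move=> l; have := latP l; case: ifP => // _; exact: sys12.
by move=> g; have [tE dE] := EP g; split=> //; exact: trans12.
Qed.

Theorem proposition2 (R : realType) (T : gpt R) (F : symmetry T)
    (F_nonphysical : nonphysical F) (C : causal_structure) :
  admits_gap (swirl F) C -> admits_gap (CPT T) C.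
Proof.
move=> [alph [_ [P [TP sTP]]]]; exists alph; split=> [Q|].
  by apply: realizable_mono => // A B f [].
(* By contraposition: a CPT realization of [P] would be one in the swirled theory. *)
exists P; split=> // cptP; apply: sTP; move: cptP.
apply: realizable_mono => // A B f; exact: cpt_trans_swirl.
Qed.
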